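(* In the setting below, let $S$ and $\delta$ be as provided by the probability estimate (i.e. such that $\mathbb{P}_{\omega_2}\{Q\text{ is bad}\}\le\delta^2$ for every $\omega_1\in\Omega$ and every $Q\in\mathcal{D}(\omega_1)$). Then for every $\omega_1\in\Omega$ and every $f\in L^2(\mathbb{R}^d;\mu)$, $$\mathbb{E}_{\omega_2}\big(\|f_{bad}\|_{L^2(\mathbb{R}^d;\mu)}\big)\le\delta\,\|f\|_{L^2(\mathbb{R}^d;\mu)}.$$
   Context: Setting: $\mu$ a probability measure on $\mathbb{R}^d$ with compact support contained in $\frac14Q_*$ for a fixed unit cube $Q_*$; $H\subset\mathbb{R}^d$ open. $\Omega=(-1/40,1/40]^d$ with normalized Lebesgue measure; for $\omega\in\Omega$, $\mathcal{D}(\omega)$ is the set of dyadic subcubes of $\omega+Q_*$; $\mathcal{D}_1=\mathcal{D}(\omega_1)$, $\mathcal{D}_2=\mathcal{D}(\omega_2)$ with $\omega_1,\omega_2$ independent. A dyadic cube $Q$ is terminal if $2Q\subset H$ or $\mu(Q)=0$, and transit otherwise. For $\mu(Q)>0$, $\langle\psi\rangle_Q=\mu(Q)^{-1}\int_Q\psi\,d\mu$; for transit $Q$ with children $Q_j$: $\Delta_Q\varphi=0$ off $Q$, $\Delta_Q\varphi=\langle\varphi\rangle_{Q_j}-\langle\varphi\rangle_Q$ on transit $Q_j$, and $\Delta_Q\varphi=\varphi-\langle\varphi\rangle_Q$ on terminal $Q_j$. Parameters: $0<\tau\le1$, $m>0$, $\alpha=\tau/(2\tau+2m)$, $\delta>0$,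 $S\ge2$, integer $r$ with $2^{-r}\le\delta^S<2^{-r+1}$. $sk\,R=\bigcup_i\partial R_i$ over the children $R_i$ of $R$. $Q\in\mathcal{D}_1$ is bad if some $R\in\mathcal{D}_2$ has $\ell(R)\ge2^r\ell(Q)$ and $\operatorname{dist}(Q,sk\,R)<\ell(Q)^\alpha\ell(R)^{1-\alpha}$. $f_{bad}=\sum\Delta_Qf$ over transit bad cubes $Q\in\mathcal{D}_1$. *)

(* Defs.v *)
From HB Require Import structures.
From mathcomp Require Import all_boot all_order all_algebra.
From mathcomp Require Import all_classical all_reals all_analysis.
Set Implicit Arguments. Unset Strict Implicit. Unset Printing Implicit Defensive.
Import Order.TTheory GRing.Theory Num.Theory.
Import numFieldNormedType.Exports.
Local Open Scope classical_set_scope.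
Local Open Scope ring_scope.

Section defs.
Variable R : realType.
Variable d : nat.

(* Points of R^d are d-tuples of reals; d.-tuple R carries the product
   (= Borel) sigma-algebra of the library. *)
Notation pt := (d.-tuple R).

Definition edist (x y : pt) : R :=
  Num.sqrt (\sum_(i < d) (tnth x i - tnth y i) ^+ 2).

Definition eball (x : pt) (e : R) : set pt := [set y | edist x y < e].

Definition eopen (A : set pt) : Prop :=
  forall x, A x -> exists2 e : R, 0 < e & eball x e `<=` A.

Definition eclosure (A : set pt) : set pt :=
  [set x | forall e : R, 0 < e -> exists2 y, A y & edist x y < e].

Definition einterior (A : set pt) : set pt :=
  [set x | exists2 e : R, 0 < e & eball x e `<=` A].

Definition eboundary (A : set pt) : set pt := eclosure A `\` einterior A.

Definition set_dist (A B : set pt) : R :=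
  inf [set edist x y | x in A & y in B].

Definition cube (a : 'I_d -> R) (l : R) : set pt :=
  [set x | forall i, a i < tnth x i <= a i + l].

Definition child_corner (a : 'I_d -> R) (l : R) (e : {ffun 'I_d -> bool}) :
  'I_d -> R := fun i => a i + (e i)%:R * (l / 2).

(* 2Q : same center, double side *)
Definition dbl_corner (a : 'I_d -> R) (l : R) : 'I_d -> R :=
  fun i => a i - l / 2.

Definition skel (a : 'I_d -> R) (l : R) : set pt :=
  \bigcup_(e in [set: {ffun 'I_d -> bool}])
     eboundary (cube (child_corner a l e) (l / 2)).

Definition side (k : nat) : R := 2 ^- k.

(* corner of the dyadic subcube of generation k with index j of the
   cube omega + Q_*, where Q_* = cube c 1 *)
Definition dcorner (c omega : pt) (k : nat) (j : {ffun 'I_d -> 'I_(2 ^ k)}) :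
  'I_d -> R := fun i => tnth c i + tnth omega i + (j i)%:R * side k.

Variable mu : probability pt R.
Variable H : set pt.

Definition terminal (a : 'I_d -> R) (l : R) : Prop :=
  cube (dbl_corner a l) (2 * l) `<=` H \/ mu (cube a l) = 0%E.
Definition transit (a : 'I_d -> R) (l : R) : Prop := ~ terminal a l.

Definition avg (A : set pt) (psi : pt -> R) : R :=
  (fine (mu A))^-1 * Rintegral mu A psi.

Definition Delta (a : 'I_d -> R) (l : R) (phi : pt -> R) (x : pt) : R :=
  \sum_(e : {ffun 'I_d -> bool})
     \1_(cube (child_corner a l e) (l / 2)) x *
     (if `[< transit (child_corner a l e) (l / 2) >]
      then avg (cube (child_corner a l e) (l / 2)) phi - avg (cube a l) phi
      else phi x - avg (cube a l) phi).

Definition bad (c : pt) (alpha : R) (r : int) (omega1 omega2 : pt)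
    (k : nat) (j : {ffun 'I_d -> 'I_(2 ^ k)}) : Prop :=
  exists k' (j' : {ffun 'I_d -> 'I_(2 ^ k')}),
    2 `^ (r%:~R) * side k <= side k' /\
    set_dist (cube (dcorner c omega1 j) (side k))
             (skel (dcorner c omega2 j') (side k'))
      < side k `^ alpha * side k' `^ (1 - alpha).

Definition fbad_gen (c : pt) (alpha : R) (r : int) (omega1 omega2 : pt)
    (f : pt -> R) (k : nat) (x : pt) : R :=
  \sum_(j : {ffun 'I_d -> 'I_(2 ^ k)} |
          `[< transit (dcorner c omega1 j) (side k) /\
              bad c alpha r omega1 omega2 j >])
     Delta (dcorner c omega1 j) (side k) f x.

(* f_bad = sum over all transit bad cubes Q in D(omega1) of Delta_Q f,
   the series being summed generation by generation *)
Definition fbad (c : pt) (alpha : R) (r : int) (omega1 omega2 : pt)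
    (f : pt -> R) (x : pt) : R :=
  limn (series (fun k => fbad_gen c alpha r omega1 omega2 f k x)).

End defs.

Section omega.
Variable R : realType.

Definition Omega (d : nat) : set (d.-tuple R) :=
  [set w | forall i, - (40 : R)^-1 < tnth w i <= (40 : R)^-1].

Definition I40 : set R := `]- (40 : R)^-1, (40 : R)^-1]%classic.

(* iterated integral against the normalized Lebesgue measure
   20 * dt on (-1/40, 1/40], in each of n coordinates *)
Fixpoint iter_avg (n : nat) (F : seq R -> \bar R) : \bar R :=
  match n with
  | 0 => F [::]
  | n.+1 => (\int[lebesgue_measure]_(t in I40)
               (20%:E * iter_avg n (fun s => F (t :: s))))%E
  end.

Definition EOmega (d : nat) (G : d.-tuple R -> \bar R) : \bar R :=
  iter_avg d (fun s => G (insubd (nseq_tuple d 0) s)).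

Definition POmega (d : nat) (A : set (d.-tuple R)) : \bar R :=
  EOmega (fun w => (\1_A w : R)%:E).

End omega.

(* Main.v *)
Require Import Defs.
From HB Require Import structures.
From mathcomp Require Import all_boot all_order all_algebra.
From mathcomp Require Import all_classical all_reals all_analysis.
From mathcomp Require Import measurable_realfun.
From mathcomp Require Import ring lra.
Set Implicit Arguments. Unset Strict Implicit. Unset Printing Implicit Defensive.
Import Order.TTheory GRing.Theory Num.Theory.
Import numFieldNormedType.Exports.
Local Open Scope classical_set_scope.
Local Open Scope ring_scope.

(** The differences [Delta_Q f], [Q] transit, are pairwise orthogonal: each has
    mean zero, and on a transit cube of a later generation [Delta_Q f] is
    constant. Since moreover [<f, Delta_Q f> = ||Delta_Q f||^2], Bessel's
    inequality bounds the sum of all [||Delta_Q f||^2] by [||f||^2], while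
    [||f_bad||^2] is at most the sum of [||Delta_Q f||^2] over the bad [Q]. The
    expectation over [omega2] of this last sum is at most [delta^2 ||f||^2], and
    [sqrt x <= x / (2 l) + l / 2] with [l] close to [delta ||f||] replaces
    Jensen's inequality.

    No almost everywhere convergence is needed: where the series defining
    [f_bad] diverges its [lim] is [0], so Fatou's lemma applies to the partial
    sums. Only the bad events have to be measurable in [omega2]; they are open,
    because the skeleton moves rigidly with [omega2]. *)

(** * Averages over the translation parameter *)

(* Unlike [ge0_le_integral], no measurability: the integral of a nonnegative
   function is a supremum over simple functions. *)
Lemma ge0_le_integral_nomeas d (T : measurableType d) (R : realType)
    (mu : {measure set T -> \bar R}) (D : set T) (f g : T -> \bar R) :
  (forall x, D x -> 0 <= f x)%E -> (forall x, D x -> f x <= g x)%E ->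
  (\int[mu]_(x in D) f x <= \int[mu]_(x in D) g x)%E.
Proof.
move=> f0 fg; rewrite !ge0_integralE//; last first.
  by move=> x Dx; exact: le_trans (f0 _ Dx) (fg _ Dx).
apply: ge_ereal_sup => _ [h /= hf <-]; apply: ereal_sup_ubound; exists h => //= x.
apply: le_trans (hf x) _; rewrite /patch; case: ifPn => // /set_mem; exact: fg.
Qed.

Section iter_avg.
Variable R : realType.
Implicit Types F G : seq R -> \bar R.
Local Open Scope ereal_scope.

Lemma iter_avg_ge0 n F : (forall s, 0 <= F s) -> 0 <= iter_avg n F.
Proof.
elim: n F => [|n IH] F F0 /=; first exact: F0.
by apply: integral_ge0 => t _; apply: mule_ge0 => //; apply: IH.
Qed.

Lemma le_iter_avg n F G : (forall s, 0 <= F s) -> (forall s, F s <= G s) ->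
  iter_avg n F <= iter_avg n G.
Proof.
elim: n F G => [|n IH] F G F0 FG /=; first exact: FG.
apply: ge0_le_integral_nomeas => t _.
  by apply: mule_ge0 => //; apply: iter_avg_ge0.
by rewrite lee_pmul2l//; apply: IH.
Qed.

Lemma lebesgue_I40 : lebesgue_measure (@I40 R) = (20^-1)%:E.
Proof.
rewrite /I40 lebesgue_measure_itv/= lte_fin ifT; last by lra.
by rewrite -EFinD; congr EFin; lra.
Qed.

Lemma measurable_I40 : measurable (@I40 R).
Proof. exact: measurable_itv. Qed.

Lemma iter_avg_cst n (a : R) : iter_avg n (fun _ : seq R => a%:E) = a%:E.
Proof.
elim: n => //= n ->.
rewrite -EFinM integral_cst//= ?lebesgue_I40; last exact: measurable_I40.
by rewrite -EFinM; congr EFin; field.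
Qed.

(** The parameter space [T] is arbitrary so that the induction closes: the next integration variable
    joins the parameters, giving [T * R], and Tonelli's theorem makes the integral over that
    variable measurable. *)
Lemma measurable_iter_avg n d (T : measurableType d) (F : T -> seq R -> \bar R) :
  (forall x s, 0 <= F x s) ->
  measurable_fun setT (fun p : T * n.-tuple R => F p.1 p.2) ->
  measurable_fun setT (fun x => iter_avg n (F x)).
Proof.
elim: n d T F => [|n IH] d T F F0 mF /=.
  have h : measurable_fun setT (fun x : T => (x, [tuple] : 0.-tuple R)).
    by apply/measurable_fun_pair => //=; exact: measurable_cst.
  exact: (measurableT_comp mF h).
(* The indicator of [I40] turns the integral over an interval into one over the whole line, the form
   in which Tonelli's theorem is applied. *)
pose G (p : T * R) := 20%:E * iter_avg n (fun s => F p.1 (p.2 :: s)) * (\1_(@I40 R) p.2 : R)%:E.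
have -> : (fun x => \int[lebesgue_measure]_(t in @I40 R)
    (20%:E * iter_avg n (fun s => F x (t :: s)))) = fubini_F lebesgue_measure G.
  by apply/funext => x; rewrite integral_mkcond epatch_indic.
apply: measurable_fun_fubini_tonelli_F; last first.
  move=> p; apply: mule_ge0; last by rewrite lee_fin.
  by apply: mule_ge0 => //; apply: iter_avg_ge0.
apply: emeasurable_funM.
  apply: emeasurable_funM; first exact: measurable_cst.
  apply: (IH _ (T * R)%type (fun p s => F p.1 (p.2 :: s))) => //=.
  have h : measurable_fun setT (fun q : (T * R) * n.-tuple R =>
      (q.1.1, [the n.+1.-tuple R of q.1.2 :: q.2])).
    apply/measurable_fun_pair => /=; first exact: measurableT_comp.
    by apply: measurable_cons => //; exact: measurableT_comp.
  exact: (measurableT_comp mF h).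
apply/measurable_EFinP; apply: measurableT_comp => //.
by apply: measurable_indic; exact: measurable_I40.
Qed.

Lemma measurable_iter_avg_cons n F : (forall s, 0 <= F s) ->
  measurable_fun setT (fun s : n.+1.-tuple R => F s) ->
  measurable_fun (@I40 R) (fun t => iter_avg n (fun s => F (t :: s))).
Proof.
move=> F0 mF; apply: measurable_funTS.
apply: (@measurable_iter_avg _ _ R (fun t s => F (t :: s))) => //=.
have h : measurable_fun setT
    (fun q : R * n.-tuple R => [the n.+1.-tuple R of q.1 :: q.2]).
  exact: measurable_cons.
exact: (measurableT_comp mF h).
Qed.

Lemma measurable_cons_tuple n F (t : R) :
  measurable_fun setT (fun s : n.+1.-tuple R => F s) ->
  measurable_fun setT (fun s : n.-tuple R => F (t :: s)).
Proof.
move=> mF.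
have h : measurable_fun setT
    (fun s : n.-tuple R => [the n.+1.-tuple R of t :: s]).
  by apply: measurable_cons => //; exact: measurable_cst.
exact: (measurableT_comp mF h).
Qed.

(** Unlike monotonicity, additivity of the integral uses measurability. It is expressed on
    [n.-tuple R], which carries the product sigma-algebra, although [F] and [G] take lists. *)
Lemma iter_avgD n F G : (forall s, 0 <= F s) -> (forall s, 0 <= G s) ->
  measurable_fun setT (fun s : n.-tuple R => F s) ->
  measurable_fun setT (fun s : n.-tuple R => G s) ->
  iter_avg n (fun s => F s + G s) = iter_avg n F + iter_avg n G.
Proof.
elim: n F G => [//|n IH] F G F0 G0 mF mG /=.
rewrite -ge0_integralD//=; last 5 first.
- exact: measurable_I40.
- by move=> t _; apply: mule_ge0 => //; exact: iter_avg_ge0.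
- apply: emeasurable_funM; first exact: measurable_cst.
  exact: measurable_iter_avg_cons.
- by move=> t _; apply: mule_ge0 => //; exact: iter_avg_ge0.
- apply: emeasurable_funM; first exact: measurable_cst.
  exact: measurable_iter_avg_cons.
apply: eq_integral => t _.
have -> := IH (fun s => F (t :: s)) (fun s => G (t :: s))
  (fun s => F0 (t :: s)) (fun s => G0 (t :: s))
  (measurable_cons_tuple t mF) (measurable_cons_tuple t mG).
by rewrite ge0_muleDr//; apply: iter_avg_ge0.
Qed.

Lemma iter_avgZ n F (k : R) : (0 <= k)%R -> (forall s, 0 <= F s) ->
  measurable_fun setT (fun s : n.-tuple R => F s) ->
  iter_avg n (fun s => k%:E * F s) = k%:E * iter_avg n F.
Proof.
move=> k0; elim: n F => [//|n IH] F F0 mF /=.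
rewrite -ge0_integralZl_EFin//=; last 3 first.
- exact: measurable_I40.
- by move=> t _; apply: mule_ge0 => //; exact: iter_avg_ge0.
- apply: emeasurable_funM; first exact: measurable_cst.
  exact: measurable_iter_avg_cons.
apply: eq_integral => t _.
have -> := IH (fun s => F (t :: s)) (fun s => F0 (t :: s))
  (measurable_cons_tuple t mF).
by rewrite muleCA.
Qed.

End iter_avg.

(** * Expectation over tuples *)

Section EOmega.
Variables (R : realType) (d : nat).
Implicit Types F G : d.-tuple R -> \bar R.
Local Open Scope ereal_scope.

(** On lists that come from a [d]-tuple, [insubd] never returns its default value. *)
Let measurable_insubd F : measurable_fun setT F ->
  measurable_fun setT (fun s : d.-tuple R => F (insubd (nseq_tuple d 0%R) (s : seq R))).
Proof.
by move=> mF; apply: eq_measurable_fun mF => s _; rewrite valKd.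
Qed.

Lemma le_EOmega F G : (forall w, 0 <= F w) -> (forall w, F w <= G w) ->
  EOmega F <= EOmega G.
Proof. by move=> F0 FG; apply: le_iter_avg => s. Qed.

Lemma EOmega_cst (a : R) : EOmega (fun _ : d.-tuple R => a%:E) = a%:E.
Proof. exact: iter_avg_cst. Qed.

Lemma EOmegaD F G : (forall w, 0 <= F w) -> (forall w, 0 <= G w) ->
  measurable_fun setT F -> measurable_fun setT G ->
  EOmega (fun w => F w + G w) = EOmega F + EOmega G.
Proof.
by move=> F0 G0 mF mG; rewrite /EOmega iter_avgD//; exact: measurable_insubd.
Qed.

Lemma EOmegaZ F (k : R) : (0 <= k)%R -> (forall w, 0 <= F w) ->
  measurable_fun setT F -> EOmega (fun w => k%:E * F w) = k%:E * EOmega F.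
Proof.
by move=> k0 F0 mF; rewrite /EOmega iter_avgZ//; exact: measurable_insubd.
Qed.

Lemma EOmega_sum I (s : seq I) (P : pred I) (F : I -> d.-tuple R -> \bar R) :
  (forall i w, 0 <= F i w) -> (forall i, measurable_fun setT (F i)) ->
  EOmega (fun w => \sum_(i <- s | P i) F i w) = \sum_(i <- s | P i) EOmega (F i).
Proof.
move=> F0 mF; elim: s => [|i s IH].
  by rewrite big_nil -[RHS]EOmega_cst; congr EOmega; apply/funext => w; rewrite big_nil.
rewrite big_cons -IH.
under [in LHS]eq_fun do rewrite big_cons.
case: ifPn => // _; rewrite EOmegaD//.
  by move=> w; exact: sume_ge0.
by under eq_fun do rewrite -big_filter; exact: emeasurable_sum.
Qed.

End EOmega.

(** * Bad events are open *)

Section geometry.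
Variables (R : realType) (d : nat).
Notation pt := (d.-tuple R).
(* The topology library has another [edist]. *)
Notation edist := Defs.edist.
Implicit Types (x y z v w : pt) (a : 'I_d -> R) (A B : set pt).

(** Cauchy-Schwarz: the sum of the squares of [P * v i - S * u i] equals [P * (P * Q - S ^+ 2)], and
    one divides by [P]. If [P = 0], all [u i] vanish. *)
Lemma sum_mul_sq_le (u v : 'I_d -> R) :
  (\sum_i u i * v i) ^+ 2 <= (\sum_i u i ^+ 2) * \sum_i v i ^+ 2.
Proof.
set P := \sum_i u i ^+ 2; set Q := \sum_i v i ^+ 2; set S := \sum_i u i * v i.
have P0 : 0 <= P by apply: sumr_ge0 => i _; exact: sqr_ge0.
have [Pe|Pn] := eqVneq P 0.
  have u0 i : u i = 0.
    apply/eqP; rewrite -sqrf_eq0; apply/eqP.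
    by have /psumr_eq0P/(_ Pe) := fun (j : 'I_d) (_ : true) => sqr_ge0 (u j); exact.
  by rewrite Pe mul0r /S big1 ?expr0n// => i _; rewrite u0 mul0r.
have : 0 <= \sum_i (P * v i - S * u i) ^+ 2 by apply: sumr_ge0 => i _; exact: sqr_ge0.
have -> : \sum_i (P * v i - S * u i) ^+ 2 = P * (P * Q - S ^+ 2).
  transitivity (P ^+ 2 * Q + (- 2 * P * S) * S + S ^+ 2 * P); last by ring.
  rewrite [in LHS](eq_bigr (fun i => P ^+ 2 * v i ^+ 2
    + (- 2 * P * S) * (u i * v i) + S ^+ 2 * u i ^+ 2)); last by move=> i _; ring.
  by rewrite !big_split /= -!mulr_sumr.
by rewrite pmulr_rge0 ?subr_ge0// lt_def Pn.
Qed.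

Lemma edist_ge0 x y : 0 <= edist x y.
Proof. exact: sqrtr_ge0. Qed.

Lemma edist_triangle x y z : edist x z <= edist x y + edist y z.
Proof.
rewrite /edist.
set P := \sum_(i < d) (tnth x i - tnth y i) ^+ 2.
set Q := \sum_(i < d) (tnth y i - tnth z i) ^+ 2.
pose S := \sum_(i < d) (tnth x i - tnth y i) * (tnth y i - tnth z i).
have P0 : 0 <= P by apply: sumr_ge0 => i _; exact: sqr_ge0.
have Q0 : 0 <= Q by apply: sumr_ge0 => i _; exact: sqr_ge0.
have -> : \sum_(i < d) (tnth x i - tnth z i) ^+ 2 = P + 2 * S + Q.
  rewrite [LHS](eq_bigr (fun i => (tnth x i - tnth y i) ^+ 2
    + 2 * ((tnth x i - tnth y i) * (tnth y i - tnth z i))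
    + (tnth y i - tnth z i) ^+ 2)); last by move=> i _; ring.
  by rewrite !big_split /= -mulr_sumr.
have SPQ : S <= Num.sqrt P * Num.sqrt Q.
  rewrite -sqrtrM// (le_trans (ler_norm _))// -sqrtr_sqr ler_wsqrtr//.
  exact: sum_mul_sq_le.
rewrite -(ger0_norm (addr_ge0 (sqrtr_ge0 P) (sqrtr_ge0 Q))) -sqrtr_sqr ler_wsqrtr//.
by rewrite sqrrD !sqr_sqrtr// -mulr_natl; lra.
Qed.

Definition tshift v x : pt := [tuple tnth x i + tnth v i | i < d].

Lemma edist_tshift v x y : edist (tshift v x) (tshift v y) = edist x y.
Proof.
by congr Num.sqrt; apply: eq_bigr => i _; rewrite !tnth_mktuple; congr (_ ^+ 2); ring.
Qed.

Lemma eboundary_tshift v A B : (forall x, A x <-> B (tshift v x)) ->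
  forall x, eboundary A x -> eboundary B (tshift v x).
Proof.
move=> AB x [cA iA]; split.
  move=> e e0; have [y Ay xy] := cA e e0.
  by exists (tshift v y); [exact/AB|rewrite edist_tshift].
apply: contra_not iA => -[e e0 eB]; exists e => // y xy.
by apply/AB/eB; rewrite /eball /= edist_tshift.
Qed.

Lemma skel_tshift v a a' l : (forall i, a' i = a i + tnth v i) ->
  forall x, skel a l x -> skel a' l (tshift v x).
Proof.
move=> aa' x [e _ ex]; exists e => //.
apply: eboundary_tshift ex => y; rewrite /cube /child_corner /=.
by split => h i; move: (h i); rewrite ?tnth_mktuple aa'; lra.
Qed.

(** A pair of points at distance less than [t] for [w] yields one for [w'] by translating the
    skeleton point by [w' - w], which changes the distance by at most [edist w w']. *)
Lemma eopen_set_dist_skel (c : pt) A k (j : {ffun 'I_d -> 'I_(2 ^ k)}) (t : R) :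
  eopen [set w | set_dist A (skel (dcorner c w j) (side R k)) < t].
Proof.
have shift w w' y : skel (dcorner c w j) (side R k) y ->
    skel (dcorner c w' j) (side R k)
      (tshift [tuple tnth w' i - tnth w i | i < d] y).
  by apply: skel_tshift => i; rewrite /dcorner tnth_mktuple; ring.
move=> w /=; rewrite /set_dist.
set D := fun w => [set edist x y | x in A & y in skel (dcorner c w j) (side R k)].
rewrite -/(D w) => wt.
have [[p Dp]|D0] := pselect (D w !=set0).
  have [_ [x Ax [y wy <-]] xyt] := inf_lt (ex_intro _ p Dp) wt.
  exists (t - edist x y); rewrite ?subr_gt0// => w' ww' /=.
  set y' := tshift [tuple tnth w' i - tnth w i | i < d] y.
  apply: (@le_lt_trans _ _ (edist x y')).
    apply: ge_inf.
      by exists 0 => _ [x1 _ [y1 _ <-]]; exact: edist_ge0.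
    by exists x => //; exists y' => //; exact: shift.
  apply: (le_lt_trans (edist_triangle x y y')).
  have -> : edist y y' = edist w w'.
    by congr Num.sqrt; apply: eq_bigr => i _; rewrite !tnth_mktuple; congr (_ ^+ 2); ring.
  by move: ww'; rewrite /eball /=; lra.
(* Here [A] or the skeleton is empty. The skeletons for [w] and [w'] are translates of each other,
   so both sets of distances are empty and have the same [inf]. *)
exists 1 => // w' _ /=.
suff -> : [set edist x y | x in A & y in skel (dcorner c w' j) (side R k)] = D w by [].
apply/seteqP; split => [_ [x Ax [y w'y <-]]|q Dq]; exfalso; apply: D0; last by exists q.
exists (edist x (tshift [tuple tnth w i - tnth w' i | i < d] y)).
by exists x => //; eexists; first exact: shift w'y.
Qed.

(** A union over [k'] and [j'] of open conditions: the distance inequality is strict and its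
    right-hand side does not depend on the shift. *)
Lemma eopen_bad (c : pt) (alpha : R) (r : int) (w1 : pt) k
    (j : {ffun 'I_d -> 'I_(2 ^ k)}) :
  eopen [set w2 | bad c alpha r w1 w2 j].
Proof.
move=> w [k' [j' [kk' wlt]]].
have [e e0 we] := eopen_set_dist_skel wlt.
by exists e => // w' /we; exists k', j'.
Qed.

(** * Measurability of cubes and open sets *)

Lemma measurable_cube a l : measurable (cube a l).
Proof.
have -> : cube a l = \bigcap_(i in [set: 'I_d])
    (fun x : pt => tnth x i) @^-1` [set` `]a i, a i + l]].
  apply/seteqP; split => x /= ax i; first by move=> _; rewrite /= in_itv /=; exact: ax.
  by have := ax i Logic.I; rewrite /= in_itv.
apply: fin_bigcap_measurable => // i _.
by rewrite -[_ @^-1` _]setTI; apply: measurable_tnth.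
Qed.

(** An open set is the union of the half-open cubes with rational corner and rational side that it
    contains, and there are countably many of these. *)
Lemma eopen_measurable A : eopen A -> measurable A.
Proof.
move=> oA.
pose box (p : {ffun 'I_d -> rat} * rat) := cube (fun i => ratr (p.1 i) : R) (ratr p.2).
have -> : A = \bigcup_p (if pselect (box p `<=` A) then box p else set0).
  apply/seteqP; split => [x Ax|x [p _]]; last first.
    by case: pselect => // pA; exact: pA.
  have [e e0 eA] := oA x Ax.
  (* A cube of side [l] has diameter at most [sqrt d * l], hence at most [(d + 1) * l]. The divisor
     [d + 1] stays positive when [d = 0]. *)
  have dpos : 0 < (d%:R + 1 : R) by rewrite ltr_pwDr.
  have [l] := rat_in_itvoo (divr_gt0 e0 dpos).
  rewrite in_itv /= => /andP[l0 le].
  have lx i : tnth x i - ratr l < tnth x i by rewrite ltrBlDr ltrDl.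
  pose q := [ffun i => projT1 (cid (rat_in_itvoo (lx i)))].
  have qP i : tnth x i - ratr l < ratr (q i) < tnth x i.
    by rewrite ffunE; case: cid => /= s; rewrite in_itv.
  exists (q, l) => //.
  have bx : box (q, l) x by move=> i /=; have := qP i; lra.
  case: pselect => // -[] y ylt; apply: eA; rewrite /eball /=.
  apply: (@le_lt_trans _ _ ((d%:R + 1) * ratr l)); last by rewrite mulrC -ltr_pdivlMr.
  have dl0 : 0 <= (d%:R + 1) * ratr l :> R by rewrite mulr_ge0// ltW.
  rewrite -[leRHS](ger0_norm dl0) -sqrtr_sqr ler_wsqrtr//.
  apply: (@le_trans _ _ (\sum_(i < d) ratr l ^+ 2)).
    apply: ler_sum => i _; have := qP i; have := ylt i => /= yq xq.
    rewrite -real_normK ?num_real// lerXn2r ?nnegrE// ?ltW//.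
    by rewrite ltr_norml; lra.
  rewrite sumr_const card_ord -[leLHS]mulr_natl [leRHS]exprMn.
  apply: ler_wpM2r; first exact: sqr_ge0.
  have : 0 <= d%:R :> R by [].
  by nra.
apply: countable_bigcupT_measurable => // p.
by case: pselect => ? /=; [exact: measurable_cube|exact: measurable0].
Qed.

Lemma measurable_bad (c : pt) (alpha : R) (r : int) (w1 : pt) k
    (j : {ffun 'I_d -> 'I_(2 ^ k)}) :
  measurable [set w2 | bad c alpha r w1 w2 j].
Proof. by apply: eopen_measurable; exact: eopen_bad. Qed.

End geometry.

(** * Square integrable functions *)

Section square_integrable.
Context d (T : measurableType d) (R : realType) (mu : probability T R).
Implicit Types f g h : T -> R.

Definition square_integrable f :=
  measurable_fun setT f /\ mu.-integrable setT (EFin \o (fun x => f x ^+ 2)).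

Definition dotL2 f g : R := Rintegral mu setT (fun x => f x * g x).

Lemma integrable_EFinD f g : mu.-integrable setT (EFin \o f) ->
  mu.-integrable setT (EFin \o g) ->
  mu.-integrable setT (EFin \o (fun x => f x + g x)).
Proof. by move=> fi gi; exact: (integrableD measurableT fi gi). Qed.

Lemma integrable_EFinZ (a : R) f : mu.-integrable setT (EFin \o f) ->
  mu.-integrable setT (EFin \o (fun x => a * f x)).
Proof. by move=> fi; exact: (integrableZl measurableT a fi). Qed.

Lemma integrable_EFinB f g : mu.-integrable setT (EFin \o f) ->
  mu.-integrable setT (EFin \o g) ->
  mu.-integrable setT (EFin \o (fun x => f x - g x)).
Proof. by move=> fi gi; exact: (integrableB measurableT fi gi). Qed.

(** The product is dominated by [f ^+ 2 + g ^+ 2]. *)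
Lemma square_integrableM f g : square_integrable f -> square_integrable g ->
  mu.-integrable setT (EFin \o (fun x => f x * g x)).
Proof.
move=> [mf f2] [mg g2].
apply: (le_integrable measurableT _ _ (integrableD measurableT f2 g2)).
  by apply/measurable_EFinP; exact: measurable_funM.
move=> x _ /=; rewrite lee_fin [leRHS]ger0_norm ?addr_ge0 ?sqr_ge0//.
by rewrite ler_norml; nra.
Qed.

Lemma square_integrable_cst (a : R) : square_integrable (fun=> a).
Proof.
split; first exact: measurable_cst.
exact: finite_measure_integrable_cst.
Qed.

Lemma square_integrable_integrable f : square_integrable f ->
  mu.-integrable setT (EFin \o f).
Proof.
move=> f2; have := square_integrableM f2 (square_integrable_cst 1).
by under eq_fun do rewrite mulr1.
Qed.

Lemma square_integrableD f g : square_integrable f -> square_integrable g ->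
  square_integrable (fun x => f x + g x).
Proof.
move=> Lf Lg; have := square_integrableM Lf Lg; case: Lf Lg => mf f2 [mg g2] fg.
split; first exact: measurable_funD.
have -> : (fun x => (f x + g x) ^+ 2) =
    (fun x => (f x ^+ 2 + g x ^+ 2) + 2 * (f x * g x)).
  by apply/funext => x; ring.
by apply: integrable_EFinD; [exact: integrable_EFinD|exact: integrable_EFinZ].
Qed.

Lemma square_integrableZ (a : R) f : square_integrable f ->
  square_integrable (fun x => a * f x).
Proof.
move=> [mf f2]; split; first exact: measurable_funM.
under eq_fun do rewrite exprMn.
exact: integrable_EFinZ.
Qed.

Lemma square_integrableB f g : square_integrable f -> square_integrable g ->
  square_integrable (fun x => f x - g x).
Proof.
move=> Lf Lg; have := square_integrableD Lf (square_integrableZ (- 1) Lg).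
by under eq_fun do rewrite mulN1r.
Qed.

Lemma square_integrable_indic (A : set T) f : measurable A ->
  square_integrable f -> square_integrable (fun x => \1_A x * f x).
Proof.
move=> mA [mf f2].
have m1 : measurable_fun setT (fun x => \1_A x * f x).
  by apply: measurable_funM => //; exact: measurable_indic.
split=> //; apply: le_integrable f2 => //.
  by apply/measurable_EFinP; exact: (measurable_funX 2 m1).
move=> x _ /=; rewrite lee_fin !normrX lerXn2r ?nnegrE// indicE.
by case: (x \in A); rewrite ?mul1r// mul0r normr0.
Qed.

Lemma square_integrable_sum I (s : seq I) (P : pred I) (F : I -> T -> R) :
  (forall i, square_integrable (F i)) ->
  square_integrable (fun x => \sum_(i <- s | P i) F i x).
Proof.
move=> LF; elim: s => [|i s IH].
  by under eq_fun do rewrite big_nil; exact: square_integrable_cst.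
under eq_fun do rewrite big_cons.
by case: (P i) => //; exact: square_integrableD.
Qed.

Lemma Rintegral_sum I (s : seq I) (P : pred I) (F : I -> T -> R) :
  (forall i, mu.-integrable setT (EFin \o F i)) ->
  Rintegral mu setT (fun x => \sum_(i <- s | P i) F i x) =
  \sum_(i <- s | P i) Rintegral mu setT (F i).
Proof.
move=> iF; elim: s => [|i s IH].
  rewrite big_nil; under eq_Rintegral do rewrite big_nil.
  by rewrite Rintegral_cst// mul0r.
rewrite big_cons -IH; under eq_Rintegral do rewrite big_cons.
case: (P i) => //; rewrite RintegralD//.
have -> : EFin \o (fun x => \sum_(j <- s | P j) F j x) =
    (fun x => \sum_(j <- s | P j) (EFin \o F j) x)%E.
  by apply/funext => x /=; rewrite sumEFin.
exact: integrable_sum.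
Qed.

Lemma Rintegral_indic (A : set T) f : measurable A ->
  Rintegral mu setT (fun x => \1_A x * f x) = Rintegral mu A f.
Proof.
move=> mA; rewrite [RHS]Rintegral_mkcond; apply: eq_Rintegral => x _.
by rewrite patch_indic mulrC.
Qed.

Lemma dotL2C f g : dotL2 f g = dotL2 g f.
Proof. by apply: eq_Rintegral => x _; rewrite mulrC. Qed.

Lemma dotL2_ge0 f : 0 <= dotL2 f f.
Proof. by apply: Rintegral_ge0 => x _; rewrite -expr2 sqr_ge0. Qed.

Lemma dotL2_suml I (s : seq I) (P : pred I) (F : I -> T -> R) g :
  (forall i, square_integrable (F i)) -> square_integrable g ->
  dotL2 (fun x => \sum_(i <- s | P i) F i x) g = \sum_(i <- s | P i) dotL2 (F i) g.
Proof.
move=> LF Lg; rewrite /dotL2.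
under eq_Rintegral do rewrite mulr_suml.
by rewrite Rintegral_sum// => i; exact: square_integrableM.
Qed.

Lemma dotL2_sumr I (s : seq I) (P : pred I) (F : I -> T -> R) g :
  (forall i, square_integrable (F i)) -> square_integrable g ->
  dotL2 g (fun x => \sum_(i <- s | P i) F i x) = \sum_(i <- s | P i) dotL2 g (F i).
Proof.
move=> LF Lg; rewrite dotL2C dotL2_suml//.
by apply: eq_bigr => i _; rewrite dotL2C.
Qed.

(** * Finite orthogonal families *)

Section orthogonal.
Variables (I : finType) (P : pred I) (F : I -> T -> R).
Hypothesis LF : forall i, square_integrable (F i).
Hypothesis orthF : forall i j, P i -> P j -> i != j -> dotL2 (F i) (F j) = 0.

Lemma pythagoras :
  dotL2 (fun x => \sum_(i | P i) F i x) (fun x => \sum_(i | P i) F i x)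
  = \sum_(i | P i) dotL2 (F i) (F i).
Proof.
rewrite dotL2_suml//; last exact: square_integrable_sum.
apply: eq_bigr => i Pi; rewrite dotL2_sumr// (bigD1 i)//= big1 ?addr0// => j /andP[Pj ji].
by rewrite orthF// eq_sym.
Qed.

(** The second hypothesis replaces normalization of the [F i]: it gives [<f, g> = ||g||^2] for their
    sum [g], hence [||f||^2 - ||g||^2 = ||f - g||^2]. *)
Lemma bessel_ineq f : square_integrable f ->
  (forall i, P i -> dotL2 f (F i) = dotL2 (F i) (F i)) ->
  \sum_(i | P i) dotL2 (F i) (F i) <= dotL2 f f.
Proof.
move=> Lf fF; set g := fun x => \sum_(i | P i) F i x.
have Lg : square_integrable g by exact: square_integrable_sum.
have gg : dotL2 g g = \sum_(i | P i) dotL2 (F i) (F i) by exact: pythagoras.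
have fg : dotL2 f g = \sum_(i | P i) dotL2 (F i) (F i).
  by rewrite dotL2_sumr//; apply: eq_bigr.
rewrite -gg -subr_ge0.
have -> : dotL2 f f - dotL2 g g = dotL2 (fun x => f x - g x) (fun x => f x - g x).
  transitivity (dotL2 f f - 2 * dotL2 f g + dotL2 g g).
    by rewrite fg gg; ring.
  rewrite /dotL2 -RintegralZl//; last exact: square_integrableM.
  rewrite -RintegralB//; last 2 first.
  - exact: square_integrableM.
  - by apply: integrable_EFinZ; exact: square_integrableM.
  rewrite -RintegralD//; last 2 first.
  - apply: integrable_EFinB; first exact: square_integrableM.
    by apply: integrable_EFinZ; exact: square_integrableM.
  - exact: square_integrableM.
  by apply: eq_Rintegral => x _; ring.
exact: dotL2_ge0.
Qed.

End orthogonal.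
End square_integrable.

(** * Martingale differences *)

Section Delta.
Variables (R : realType) (d : nat) (mu : probability (d.-tuple R) R).
Variable H : set (d.-tuple R).
Notation pt := (d.-tuple R).
Implicit Types (a : 'I_d -> R) (l : R) (e : {ffun 'I_d -> bool}) (f : pt -> R).

Definition child a l e : set pt := cube (child_corner a l e) (l / 2).

Definition Delta_child a l f e (x : pt) : R :=
  if `[< transit mu H (child_corner a l e) (l / 2) >]
  then avg mu (child a l e) f - avg mu (cube a l) f
  else f x - avg mu (cube a l) f.

Lemma child_sub a l e : 0 < l -> child a l e `<=` cube a l.
Proof.
move=> l0 x ex i; have := ex i; rewrite /child_corner; case: (e i) => /=.
  by rewrite mul1r; lra.
by rewrite mul0r; lra.
Qed.

Lemma child_inj a l e e' (x : pt) : child a l e x -> child a l e' x -> e = e'.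
Proof.
move=> ex e'x; apply/ffunP => i; have := ex i; have := e'x i; rewrite /child_corner.
by case: (e i); case: (e' i) => //=; rewrite mul1r mul0r; lra.
Qed.

Lemma cube_child a l (x : pt) : cube a l x -> exists e, child a l e x.
Proof.
(* The comparison with the midpoint is strict because cubes are open on the left and closed on the
   right. *)
move=> ax; exists [ffun i => a i + l / 2 < tnth x i] => i.
have := ax i; rewrite /child_corner ffunE.
by case: (ltP (a i + l / 2) (tnth x i)) => /=; rewrite ?mul1r ?mul0r; lra.
Qed.

Lemma sum_indic_child a l (g : {ffun 'I_d -> bool} -> R) e (x : pt) :
  child a l e x -> \sum_e' \1_(child a l e') x * g e' = g e.
Proof.
move=> ex; rewrite (bigD1 e)//= indicE mem_set// mul1r big1 ?addr0// => e' /eqP e'e.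
rewrite indicE memNset ?mul0r// => e'x; apply: e'e; exact: child_inj e'x ex.
Qed.

Lemma sum_indic_notin a l (g : {ffun 'I_d -> bool} -> R) (x : pt) : 0 < l ->
  ~ cube a l x -> \sum_e' \1_(child a l e') x * g e' = 0.
Proof.
move=> l0 ax; rewrite big1// => e _.
by rewrite indicE memNset ?mul0r// => /(child_sub l0).
Qed.

Lemma DeltaE a l f (x : pt) :
  Delta mu H a l f x = \sum_e \1_(child a l e) x * Delta_child a l f e x.
Proof. by []. Qed.

Lemma Delta_notin a l f (x : pt) : 0 < l -> ~ cube a l x -> Delta mu H a l f x = 0.
Proof. by move=> l0 ax; rewrite DeltaE sum_indic_notin. Qed.

Lemma fine_measure_avg (A : set pt) f : measurable A -> mu A <> 0%E ->
  fine (mu A) * avg mu A f = Rintegral mu A f.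
Proof.
move=> mA A0; rewrite /avg mulVKf//.
by apply: contra_notN A0 => /eqP A0; rewrite -[mu A]fineK ?A0// fin_num_measure.
Qed.

Lemma square_integrable_Delta_child a l f e : square_integrable mu f ->
  square_integrable mu (Delta_child a l f e).
Proof.
move=> Lf; rewrite /Delta_child; case: asbool.
  exact: square_integrable_cst.
exact: square_integrableB (square_integrable_cst _ _).
Qed.

Lemma square_integrable_Delta a l f : square_integrable mu f ->
  square_integrable mu (Delta mu H a l f).
Proof.
move=> Lf; apply: square_integrable_sum => e; apply: square_integrable_indic.
  exact: measurable_cube.
exact: square_integrable_Delta_child.
Qed.

Lemma sum_Rintegral_child a l f : 0 < l -> square_integrable mu f ->
  \sum_e Rintegral mu (child a l e) f = Rintegral mu (cube a l) f.
Proof.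
move=> l0 Lf; rewrite -Rintegral_indic; last exact: measurable_cube.
transitivity (\sum_e Rintegral mu setT (fun x => \1_(child a l e) x * f x)).
  by apply: eq_bigr => e _; rewrite Rintegral_indic//; exact: measurable_cube.
rewrite -Rintegral_sum; last first.
  move=> e; apply: square_integrable_integrable; apply: square_integrable_indic => //.
  exact: measurable_cube.
apply: eq_Rintegral => x _; have [ax|ax] := pselect (cube a l x).
  have [e ex] := cube_child ax.
  by rewrite (sum_indic_child (fun=> f x) ex) indicE mem_set// mul1r.
by rewrite sum_indic_notin// indicE memNset// mul0r.
Qed.

(** Both kinds of child give the same formula, because replacing [f] by its average over a child of
    positive measure preserves the integral there. *)
Lemma Rintegral_Delta_child a l f e : square_integrable mu f ->
  Rintegral mu (child a l e) (Delta_child a l f e) =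
  Rintegral mu (child a l e) f - avg mu (cube a l) f * fine (mu (child a l e)).
Proof.
move=> Lf; have mc : measurable (child a l e) by exact: measurable_cube.
have fi : mu.-integrable (child a l e) (EFin \o f).
  exact: integrableS (square_integrable_integrable Lf).
rewrite /Delta_child; case: asboolP => [tr|_].
  have me : mu (child a l e) <> 0%E by move=> me; apply: tr; right.
  by rewrite Rintegral_cst// mulrBl mulrC fine_measure_avg.
by rewrite RintegralB// ?Rintegral_cst//; exact: finite_measure_integrable_cst.
Qed.

(** Summed over the children, the integrals of [f] give the integral over the cube, and the
    subtracted terms give the average times the measure of the cube. *)
Lemma Rintegral_Delta a l f : 0 < l -> mu (cube a l) <> 0%E ->
  square_integrable mu f -> Rintegral mu setT (Delta mu H a l f) = 0.
Proof.
move=> l0 m0 Lf; rewrite Rintegral_sum; last first.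
  move=> e; apply: square_integrable_integrable; apply: square_integrable_indic.
    exact: measurable_cube.
  exact: square_integrable_Delta_child.
transitivity (\sum_e (Rintegral mu (child a l e) f
    - avg mu (cube a l) f * fine (mu (child a l e)))).
  apply: eq_bigr => e _; rewrite Rintegral_indic ?Rintegral_Delta_child//.
  exact: measurable_cube.
have sm : \sum_e fine (mu (child a l e)) = fine (mu (cube a l)).
  transitivity (\sum_e Rintegral mu (child a l e) (fun=> 1)).
    by apply: eq_bigr => e _; rewrite Rintegral_cst ?mul1r//; exact: measurable_cube.
  rewrite sum_Rintegral_child//; last exact: square_integrable_cst.
  by rewrite Rintegral_cst ?mul1r//; exact: measurable_cube.
by rewrite sumrB -mulr_sumr sm sum_Rintegral_child// mulrC fine_measure_avg ?subrr//; exact: measurable_cube.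
Qed.

(* On a transit child [f - Delta f] is [f - <f>_child + <f>_cube], and on a
   terminal one it is [<f>_cube]. *)
Lemma dotL2_Delta a l f : 0 < l -> mu (cube a l) <> 0%E -> square_integrable mu f ->
  dotL2 mu f (Delta mu H a l f) = dotL2 mu (Delta mu H a l f) (Delta mu H a l f).
Proof.
move=> l0 m0 Lf; have LD := square_integrable_Delta a l Lf.
set D := Delta mu H a l f; set q := avg mu (cube a l) f.
(* [T e] is the constant value of [D] on a transit child, and [0] on a terminal one. *)
pose T e := if `[< transit mu H (child_corner a l e) (l / 2) >]
  then avg mu (child a l e) f - q else 0.
have LT e : square_integrable mu
    (fun x => T e * (\1_(child a l e) x * (f x - avg mu (child a l e) f))).
  apply: square_integrableZ; apply: square_integrable_indic.
    exact: measurable_cube.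
  exact: square_integrableB (square_integrable_cst _ _).
suff E : Rintegral mu setT (fun x => f x * D x - D x * D x) = 0.
  by apply/eqP; rewrite -subr_eq0 -E RintegralB//; exact: square_integrableM.
(* This is [(f - D) * D] computed child by child. The first term has integral zero by
   [Rintegral_Delta], and each term of the sum because [f] minus its average over a transit child
   has mean zero there. *)
transitivity (Rintegral mu setT (fun x => q * D x +
    \sum_e T e * (\1_(child a l e) x * (f x - avg mu (child a l e) f)))).
  apply: eq_Rintegral => x _; have [ax|ax] := pselect (cube a l x); last first.
    rewrite /D Delta_notin// big1 ?mulr0 ?subr0 ?addr0// => e _.
    by rewrite indicE memNset ?mul0r ?mulr0// => /(child_sub l0).
  have [e ex] := cube_child ax.
  under eq_bigr do rewrite mulrCA.
  rewrite (sum_indic_child (fun e => T e * (f x - avg mu (child a l e) f)) ex).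
  rewrite /D DeltaE (sum_indic_child (fun e => Delta_child a l f e x) ex).
  by rewrite /T /Delta_child -/q; case: asbool; ring.
rewrite RintegralD//; last 2 first.
- exact: integrable_EFinZ (square_integrable_integrable LD).
- by apply: square_integrable_integrable; exact: square_integrable_sum.
rewrite RintegralZl//; last exact: square_integrable_integrable.
rewrite Rintegral_Delta// mulr0 add0r Rintegral_sum; last first.
  by move=> e; exact: square_integrable_integrable.
apply: big1 => e _.
have mc : measurable (child a l e) by exact: measurable_cube.
rewrite RintegralZl//; last first.
  apply: square_integrable_integrable; apply: square_integrable_indic => //.
  exact: square_integrableB (square_integrable_cst _ _).
rewrite /T; case: asboolP => [tr|_]; last by rewrite mul0r.
have me : mu (child a l e) <> 0%E by move=> me; apply: tr; right.
rewrite Rintegral_indic// RintegralB//; last 2 first.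
- exact: integrableS (square_integrable_integrable Lf).
- exact: finite_measure_integrable_cst.
by rewrite Rintegral_cst// mulrC [_ * fine _]mulrC fine_measure_avg// subrr mul0r.
Qed.

(** Nested cubes have nested doubles, and a subcube of a null cube is null. The contrapositive is
    what matters: a cube containing a transit cube is transit. *)
Lemma terminal_sub a l a' l' : 0 < l' ->
  (forall i, a i <= a' i /\ a' i + l' <= a i + l) ->
  terminal mu H a l -> terminal mu H a' l'.
Proof.
move=> l0 sub [aH|a0]; [left|right].
  apply: subset_trans aH => x xa i; have := xa i; have := sub i.
  by rewrite /dbl_corner; lra.
apply: (subset_measure0 _ _ _ a0); try exact: measurable_cube.
by move=> x xa i; have := xa i; have := sub i; lra.
Qed.

End Delta.

(** * Orthogonality on a dyadic grid *)

Section dyadic.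
Variables (R : realType) (d : nat).
Notation pt := (d.-tuple R).
Notation idx k := {ffun 'I_d -> 'I_(2 ^ k)}.

Lemma side_gt0 k : 0 < side R k.
Proof. by rewrite /side invr_gt0 exprn_gt0. Qed.

Lemma sideD k p : side R k = (2 ^ p)%:R * side R (k + p).
Proof. by rewrite /side natrX exprD invfM mulrCA divff ?mulr1// expf_neq0. Qed.

Lemma half_side k : side R k / 2 = side R k.+1.
Proof. by rewrite (sideD k 1) addn1 expn1; field. Qed.

(** Comparing the open left end of one interval with the closed right end of the other gives strict
    inequalities between integer multiples of [s]. *)
Lemma nested_cells (b s x : R) (m N K : nat) : 0 < s ->
  b + m%:R * s < x <= b + m%:R * s + s ->
  b + N%:R * s < x <= b + N%:R * s + K%:R * s -> (N <= m < N + K)%N.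
Proof.
move=> s0 /andP[mx xm] /andP[Nx xN]; apply/andP; split.
  rewrite -ltnS -(ltr_nat R) -(ltr_pM2r s0) -natr1; lra.
by rewrite -(ltr_nat R) -(ltr_pM2r s0) natrD; lra.
Qed.

Lemma dcorner_inj (c w : pt) k (j j' : idx k) (x : pt) :
  cube (dcorner c w j) (side R k) x -> cube (dcorner c w j') (side R k) x -> j = j'.
Proof.
move=> jx j'x; apply/ffunP => i; apply/val_inj => /=.
have j'xi := j'x i; rewrite -[X in _ <= _ + X]mul1r in j'xi.
have := nested_cells (K := 1) (side_gt0 k) (jx i) j'xi.
by rewrite addn1 ltnS -eqn_leq => /eqP.
Qed.

(** With [k' = k.+1 + p], the child is in each coordinate a block of [2 ^ p] consecutive cells of
    generation [k'], so a cell that meets it lies inside it. *)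
Lemma dcorner_nested (c w : pt) k (j : idx k) e k' (j' : idx k') (x : pt) :
  (k < k')%N -> child (dcorner c w j) (side R k) e x ->
  cube (dcorner c w j') (side R k') x -> forall i,
  child_corner (dcorner c w j) (side R k) e i <= dcorner c w j' i /\
  dcorner c w j' i + side R k' <=
    child_corner (dcorner c w j) (side R k) e i + side R k / 2.
Proof.
move=> /subnKC; move: (k' - k.+1)%N => p kp ex j'x i.
have hs : side R k / 2 = (2 ^ p)%:R * side R k' by rewrite half_side (sideD _ p) kp.
have ce : child_corner (dcorner c w j) (side R k) e i =
    tnth c i + tnth w i + ((2 * j i + e i) * 2 ^ p)%:R * side R k'.
  rewrite /child_corner /dcorner natrM natrD natrM -mulrA -hs.
  by field.
have s0 := side_gt0 k'.
have exi := ex i; rewrite ce hs in exi.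
have /andP[Nm mN] := nested_cells s0 (j'x i) exi.
rewrite ce hs /dcorner; split; first by rewrite lerD2l ler_pM2r// ler_nat.
move: mN; rewrite -(ler_nat R) natrD -natr1 -(ler_pM2r s0) !mulrDl mul1r; lra.
Qed.

Variables (mu : probability pt R) (H : set pt).

Lemma dotL2_Delta_nested (c w : pt) k (j : idx k) k' (j' : idx k') (f : pt -> R) :
  (k < k')%N -> square_integrable mu f ->
  transit mu H (dcorner c w j') (side R k') ->
  dotL2 mu (Delta mu H (dcorner c w j) (side R k) f)
           (Delta mu H (dcorner c w j') (side R k') f) = 0.
Proof.
move=> kk' Lf tr.
set D := Delta mu H (dcorner c w j) (side R k) f.
set P := cube (dcorner c w j') (side R k').
(* A child that meets [P] contains [P] and is transit because [P] is, so each term of [D] has the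
   same value at any two points of [P]. If no child meets [P], all terms vanish there. *)
have [C DC] : exists C, forall x, P x -> D x = C.
  have [[x0 Px0]|P0] := pselect (P !=set0); last first.
    by exists 0 => x Px; exfalso; apply: P0; exists x.
  have sub e x : P x -> child (dcorner c w j) (side R k) e x ->
      P `<=` child (dcorner c w j) (side R k) e /\
      transit mu H (child_corner (dcorner c w j) (side R k) e) (side R k / 2).
    move=> Px ex; have nest := dcorner_nested kk' ex Px; split.
      by move=> y Py i; have := nest i; have := Py i; lra.
    by apply: contra_not tr; exact: terminal_sub (side_gt0 _) nest.
  exists (D x0) => x Px; apply: eq_bigr => e _.
  have [ex|ex] := pselect (child (dcorner c w j) (side R k) e x).
    have [Pe te] := sub e x Px ex.
    rewrite !indicE !mem_set//; last exact: Pe.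
    by rewrite asboolT.
  rewrite !indicE !memNset ?mul0r// => ex0; apply: ex.
  by have [Pe _] := sub e x0 Px0 ex0; exact: Pe.
have m0 : mu P <> 0%E by move=> m0; apply: tr; right.
set D' := Delta mu H (dcorner c w j') (side R k') f.
have ID' : Rintegral mu setT D' = 0 by exact: Rintegral_Delta (side_gt0 k') m0 Lf.
have LD' : square_integrable mu D' by exact: square_integrable_Delta.
have D'0 x : ~ P x -> D' x = 0 by exact: Delta_notin (side_gt0 k').
(* From here on only the zero mean, the integrability and the support of [D'] are used. *)
move: (D') ID' LD' D'0 => {}D' ID' LD' D'0.
rewrite /dotL2 -[RHS](mulr0 C) -[X in C * X]ID' -RintegralZl//; last first.
  exact: square_integrable_integrable.
apply: eq_Rintegral => x _; have [/DC->//|/D'0->] := pselect (P x).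
by rewrite !mulr0.
Qed.

Lemma dotL2_Delta_disjoint (c w : pt) k (j j' : idx k) (f : pt -> R) : j != j' ->
  dotL2 mu (Delta mu H (dcorner c w j) (side R k) f)
           (Delta mu H (dcorner c w j') (side R k) f) = 0.
Proof.
move=> jj'; transitivity (Rintegral mu setT (fun=> 0)); last first.
  by rewrite Rintegral_cst// mul0r.
apply: eq_Rintegral => x _.
have [jx|jx] := pselect (cube (dcorner c w j) (side R k) x); last first.
  by rewrite (Delta_notin _ _ _ (side_gt0 k) jx) mul0r.
rewrite (@Delta_notin _ _ _ _ (dcorner c w j')) ?mulr0//; first exact: side_gt0.
by move=> j'x; move/eqP: jj'; apply; exact: dcorner_inj jx j'x.
Qed.

(** * Sums over several generations *)

Section sums.
Variables (c w : pt) (f : pt -> R).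
Hypothesis Lf : square_integrable mu f.

Let tr k (j : idx k) := transit mu H (dcorner c w j) (side R k).
Definition gridDelta k (j : idx k) := Delta mu H (dcorner c w j) (side R k) f.

(** Indices of different generations have different types, so distinctness of cubes is expressed in
    the sigma type. *)
Lemma dotL2_gridDelta k (j : idx k) k' (j' : idx k') : tr j -> tr j' ->
  Tagged (fun k => idx k) j != Tagged (fun k => idx k) j' ->
  dotL2 mu (gridDelta j) (gridDelta j') = 0.
Proof.
move=> tj tj'; have [kk'|kk'|kk'] := ltngtP k k'.
- by move=> _; exact: dotL2_Delta_nested.
- by move=> _; rewrite dotL2C; exact: dotL2_Delta_nested.
subst k' => jj'; apply: dotL2_Delta_disjoint.
by apply: contra_neq jj' => ->.
Qed.

(** The cubes of the first [n] generations form a single finite type, to which [pythagoras] and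
    [bessel_ineq] apply; [tagI] forgets the bound on the generation. *)
Let Idx n := {k : 'I_n & idx k}.
Let tagI n (p : Idx n) : {k : nat & idx k} := Tagged (fun k => idx k) (tagged p).

Let tagI_inj n : injective (@tagI n).
Proof.
case=> k j [k' j'] /= E.
have kk' : k = k' by apply/val_inj; exact: (congr1 tag E).
by subst k'; move/eqP: E; rewrite /tagI /= eq_Tagged => /eqP /= ->.
Qed.

(** The selection [P] is arbitrary among transit cubes, so that it can be the set of bad ones for a
    given shift. *)
Lemma dotL2_sum_gridDelta n (P : forall k, pred (idx k)) :
  (forall k j, P k j -> tr j) ->
  let S x := \sum_(0 <= k < n) \sum_(j : idx k | P k j) gridDelta j x in
  dotL2 mu S S = \sum_(0 <= k < n) \sum_(j : idx k | P k j)
    dotL2 mu (gridDelta j) (gridDelta j).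
Proof.
move=> Ptr S; rewrite big_mkord (sig_big_dep xpredT (fun k : 'I_n => P k)
  (fun k j => dotL2 mu (gridDelta j) (gridDelta j))) /=.
rewrite -(pythagoras (fun p : Idx n => square_integrable_Delta H _ _ Lf)).
  by congr dotL2; apply/funext => x; rewrite /S big_mkord;
    exact: (sig_big_dep xpredT (fun k : 'I_n => P k)
    (fun (k : 'I_n) (j : idx k) => gridDelta j x)).
move=> p q /Ptr tp /Ptr tq pq; apply: dotL2_gridDelta => //.
by apply: contra_neq pq; exact: tagI_inj.
Qed.

Lemma bessel_gridDelta n :
  \sum_(0 <= k < n) \sum_(j : idx k | `[< tr j >])
    dotL2 mu (gridDelta j) (gridDelta j) <= dotL2 mu f f.
Proof.
rewrite big_mkord (sig_big_dep xpredT (fun (k : 'I_n) (j : idx k) => `[< tr j >])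
  (fun k j => dotL2 mu (gridDelta j) (gridDelta j))) /=.
apply: (bessel_ineq (fun p : Idx n => square_integrable_Delta H _ _ Lf)) => //.
  move=> p q /asboolP tp /asboolP tq pq; apply: dotL2_gridDelta => //.
  by apply: contra_neq pq; exact: tagI_inj.
move=> p /asboolP tp; apply: dotL2_Delta => //; first exact: side_gt0.
by move=> m0; apply: tp; right.
Qed.

End sums.
End dyadic.

(** * The norm of a limit of partial sums *)

Section norm.
Context d (T : measurableType d) (R : realType) (mu : probability T R).
Implicit Types f g : T -> R.

Lemma Lnorm2E f :
  ('N[mu]_2%:E[EFin \o f])%E = ((\int[mu]_x (f x ^+ 2)%:E) `^ 2^-1)%E.
Proof.
rewrite unlock /Lnorm; congr (_ `^ _)%E; apply: eq_integral => x _ /=.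
by rewrite powR_mulrn// -normrX ger0_norm// sqr_ge0.
Qed.

Lemma Lnorm2_square_integrable f : measurable_fun setT f ->
  (('N[mu]_2%:E[EFin \o f])%E < +oo)%E -> square_integrable mu f.
Proof.
move=> mf; rewrite Lnorm2E => fi; split=> //; apply/integrableP; split.
  by apply/measurable_EFinP; exact: measurable_funX.
under eq_integral do rewrite /= ger0_norm ?sqr_ge0//.
by apply: lty_poweRy fi; rewrite invr_neq0.
Qed.

Lemma integral_sqr f : square_integrable mu f ->
  (\int[mu]_x (f x ^+ 2)%:E = (dotL2 mu f f)%:E)%E.
Proof.
move=> [_ f2]; rewrite /dotL2 /Rintegral fineK//.
exact: (integrable_fin_num measurableT f2).
Qed.

Lemma Lnorm2_dotL2 f : square_integrable mu f ->
  ('N[mu]_2%:E[EFin \o f])%E = (Num.sqrt (dotL2 mu f f))%:E.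
Proof. by move=> Lf; rewrite Lnorm2E integral_sqr// poweR_EFin powR12_sqrt// dotL2_ge0. Qed.

(* [lim] of a divergent sequence is [0]. *)
Lemma sqr_limn_le_einf (u : R^nat) :
  (((limn u) ^+ 2)%:E <= limn_einf (fun n => (u n ^+ 2)%:E))%E.
Proof.
have [cu|dvgu] := pselect (cvgn u).
  have /cvg_limn_einf_sup[-> _] // : (u n ^+ 2)%:E @[n --> \oo] --> ((limn u) ^+ 2)%:E.
  by apply: cvg_EFin; [exact: nearW|apply: cvgM].
rewrite (dvgP dvgu) limn_einf_lim.
have -> : (point : R) ^+ 2 = 0 by rewrite expr0n.
apply: lime_ge; first exact: is_cvg_einfs.
by apply: nearW => n; apply: le_ereal_inf_tmp => _ [m _ <-]; rewrite lee_fin sqr_ge0.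
Qed.

Lemma limn_einf_le (u : (\bar R)^nat) (b : \bar R) :
  (forall n, u n <= b)%E -> (limn_einf u <= b)%E.
Proof.
move=> ub; rewrite limn_einf_lim; apply: lime_le; first exact: is_cvg_einfs.
by apply: nearW => n; apply: le_trans (ub n); apply: ereal_inf_lbound; exists n => /=.
Qed.

(** Fatou's lemma for the squares [u n x ^+ 2], whose lower limit dominates the square of [limn]
    even at points of divergence. *)
Lemma Lnorm2_limn_le (u : (T -> R)^nat) (B : R) :
  (forall n, square_integrable mu (u n)) -> (forall n, dotL2 mu (u n) (u n) <= B) ->
  (('N[mu]_2%:E[EFin \o (fun x => limn (u ^~ x))])%E <= (Num.sqrt B)%:E)%E.
Proof.
move=> Lu uB; have B0 : 0 <= B by exact: le_trans (dotL2_ge0 _ _) (uB 0).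
rewrite Lnorm2E -(powR12_sqrt B0) -poweR_EFin.
apply: gt0_ler_poweR => //; rewrite ?nnegrE ?in_itv /= ?leey ?andbT ?lee_fin//.
  by apply: integral_ge0 => x _; rewrite lee_fin sqr_ge0.
apply: (@le_trans _ _ (\int[mu]_x limn_einf (fun n => (u n x ^+ 2)%:E))%E).
  apply: ge0_le_integral_nomeas => x _; first by rewrite lee_fin sqr_ge0.
  exact: sqr_limn_le_einf.
apply: le_trans (fatou mu measurableT _ _) _.
- by move=> n; apply/measurable_EFinP; apply: measurable_funX; have [] := Lu n.
- by move=> n x _; rewrite lee_fin sqr_ge0.
by apply: limn_einf_le => n; rewrite integral_sqr// lee_fin.
Qed.

End norm.

(** With [s] the square root, the two sides differ by [(s - l) ^+ 2 / (2 * l)]. The bound is affine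
    in [x], so it can be averaged by linearity. *)
Lemma sqrt_le_amgm (R : rcfType) (x l : R) : 0 <= x -> 0 < l ->
  Num.sqrt x <= x / (2 * l) + l / 2.
Proof.
move=> x0 l0; rewrite -{2}(sqr_sqrtr x0); set s := Num.sqrt x.
have -> : s ^+ 2 / (2 * l) + l / 2 = s + (s - l) ^+ 2 / (2 * l).
  by field; rewrite gt_eqF.
by rewrite lerDl divr_ge0 ?sqr_ge0// mulr_ge0// ltW.
Qed.

(** * The bad part *)

Section bad_part.
Variables (R : realType) (d : nat) (mu : probability (d.-tuple R) R).
Variables (H : set (d.-tuple R)) (c : d.-tuple R) (alpha : R) (r : int).
Variables (w1 : d.-tuple R) (f : d.-tuple R -> R).
Hypothesis Lf : square_integrable mu f.
Notation idx k := {ffun 'I_d -> 'I_(2 ^ k)}.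
Notation bad2 j := [set w2 | bad c alpha r w1 w2 j].

Let tr k (j : idx k) := transit mu H (dcorner c w1 j) (side R k).

Definition energy k (j : idx k) : R :=
  dotL2 mu (gridDelta mu H c w1 f j) (gridDelta mu H c w1 f j).

Lemma energy_ge0 k (j : idx k) : 0 <= energy j.
Proof. exact: dotL2_ge0. Qed.

Definition transit_energy n : R :=
  \sum_(0 <= k < n) \sum_(j : idx k | `[< tr j >]) energy j.

(** Badness enters as an indicator factor and not as a summation condition: the index set is then
    fixed, and the sum is a finite combination of measurable functions of [w2]. *)
Definition bad_energy w2 n : R :=
  \sum_(0 <= k < n) \sum_(j : idx k | `[< tr j >]) energy j * \1_(bad2 j) w2.

Lemma transit_energy_le n : transit_energy n <= dotL2 mu f f.
Proof. exact: bessel_gridDelta. Qed.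

(** The right-hand side does not depend on [n']: generations from [n] on contribute at most the tail
    of the transit energies, which is the same for all [w2]. Expectations are thus taken of finite
    sums only. *)
Lemma bad_energy_le w2 n n' :
  bad_energy w2 n' <= bad_energy w2 n + (sup (range transit_energy) - transit_energy n).
Proof.
have le_sup m : transit_energy m <= sup (range transit_energy).
  apply: sup_upper_bound; last by exists m.
  split; first by exists (transit_energy 0), 0%N.
  by exists (dotL2 mu f f) => _ [k _ <-]; exact: transit_energy_le.
have e0 k : 0 <= \sum_(j : idx k | `[< tr j >]) energy j * \1_(bad2 j) w2.
  by apply: sumr_ge0 => j _; rewrite mulr_ge0// energy_ge0.
have [nn'|n'n] := leqP n n'.
  apply: (@le_trans _ _ (bad_energy w2 n + (transit_energy n' - transit_energy n))).
    rewrite /bad_energy /transit_energy !(@big_cat_nat _ _ _ n 0 n')//= addrAC subrr add0r.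
    rewrite lerD2l; apply: ler_sum => k _; apply: ler_sum => j _.
    by rewrite ler_piMr ?energy_ge0// indicE lern1; case: (_ \in _).
  by rewrite lerD2l lerD2r.
apply: (@le_trans _ _ (bad_energy w2 n)); last by rewrite lerDl subr_ge0.
rewrite /bad_energy (@big_cat_nat _ _ _ n' 0 n)//=; last exact: ltnW.
by rewrite lerDl; apply: sumr_ge0 => k _; exact: e0.
Qed.

(** By orthogonality the partial sum of [fbad] over [n'] generations has squared norm
    [bad_energy w2 n'], which is bounded uniformly in [n']; then [Lnorm2_limn_le] applies. *)
Lemma Lnorm2_fbad_le w2 n :
  ('N[mu]_2%:E[EFin \o fbad mu H c alpha r w1 w2 f] <=
   (Num.sqrt (bad_energy w2 n
     + (sup (range transit_energy) - transit_energy n)))%:E)%E.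
Proof.
pose P k (j : idx k) := `[< tr j /\ bad c alpha r w1 w2 j >].
have LD k (j : idx k) : square_integrable mu (gridDelta mu H c w1 f j).
  exact: square_integrable_Delta.
apply: Lnorm2_limn_le => n'.
  apply: square_integrable_sum => k; apply: square_integrable_sum => j; exact: LD.
have Ptr k (j : idx k) : P k j -> tr j by move=> /asboolP[].
apply: le_trans (bad_energy_le w2 n n').
rewrite [leLHS](dotL2_sum_gridDelta Lf n' Ptr) le_eqVlt; apply/orP; left; apply/eqP.
apply: eq_bigr => k _; rewrite /P; under eq_bigl do rewrite asbool_and.
rewrite big_mkcondr; apply: eq_bigr => j _; rewrite indicE.
case: asboolP => bj; first by rewrite mem_set// mulr1.
by rewrite memNset// mulr0.
Qed.

(** Linearity of the average and the probability bound for each cube. The affine form is the one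
    produced by [sqrt_le_amgm]. *)
Lemma EOmega_bad_energy_le (delta : R) n (a b : R) : 0 <= a -> 0 <= b ->
  (forall k (j : idx k), (POmega (bad2 j) <= (delta ^+ 2)%:E)%E) ->
  (EOmega (fun w2 => (a * bad_energy w2 n + b)%:E) <=
   (a * (delta ^+ 2 * transit_energy n) + b)%:E)%E.
Proof.
move=> a0 b0 Hprob.
pose B k (j : idx k) w2 : \bar R := ((a * energy j)%:E * (\1_(bad2 j) w2 : R)%:E)%E.
have m1 k (j : idx k) : measurable_fun setT (fun w2 => (\1_(bad2 j) w2 : R)%:E).
  by apply/measurable_EFinP/measurable_indic; exact: measurable_bad.
have B0 k (j : idx k) w2 : (0 <= B k j w2)%E.
  by rewrite /B -EFinM lee_fin !mulr_ge0// energy_ge0.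
have mB k (j : idx k) : measurable_fun setT (B k j).
  by apply: emeasurable_funM => //; exact: measurable_cst.
have E w2 : (a * bad_energy w2 n + b)%:E =
    (\sum_(0 <= k < n) \sum_(j : idx k | `[< tr j >]) B k j w2 + b%:E)%E.
  rewrite EFinD; congr (_ + _)%E; rewrite /bad_energy mulr_sumr -sumEFin.
  apply: eq_bigr => k _; rewrite mulr_sumr -sumEFin; apply: eq_bigr => j _.
  by rewrite /B -EFinM mulrA.
under eq_fun do rewrite E.
have Sm k : measurable_fun setT (fun w2 => \sum_(j : idx k | `[< tr j >]) B k j w2)%E.
  by under eq_fun do rewrite -big_filter; exact: emeasurable_sum.
have S0 k w2 : (0 <= \sum_(j : idx k | `[< tr j >]) B k j w2)%E by exact: sume_ge0.
rewrite EOmegaD//; last 2 first.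
- by move=> w; exact: sume_ge0.
- exact: emeasurable_sum.
rewrite EOmega_cst EFinD leeD2r// EOmega_sum// /transit_energy !mulr_sumr -sumEFin.
apply: lee_sum => k _; rewrite EOmega_sum// !mulr_sumr -sumEFin.
apply: lee_sum => j _; rewrite /B EOmegaZ//; last first.
  by rewrite mulr_ge0// energy_ge0.
apply: le_trans (lee_wpmul2l _ (Hprob k j)) _.
  by rewrite lee_fin mulr_ge0// energy_ge0.
by rewrite -EFinM lee_fin [leRHS](_ : _ = a * energy j * delta ^+ 2)//; ring.
Qed.

End bad_part.

Theorem theorem16 (R : realType) (d : nat)
  (mu : probability (d.-tuple R) R) (H : set (d.-tuple R))
  (c : d.-tuple R)
  (tau m delta S : R) (r : int)
  (Hsupp : [set x | forall e : R, 0 < e -> (0 < mu (eball x e))%E]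
             `<=` cube (fun i => tnth c i + 3 / 8) (1 / 4))
  (Hopen : eopen H)
  (Htau : 0 < tau <= 1) (Hm : 0 < m) (Hdelta : 0 < delta) (HS : 2 <= S)
  (Hr : 2 `^ (- r%:~R) <= delta `^ S < 2 `^ (- r%:~R + 1))
  (Hprob : forall (omega1 : d.-tuple R), Omega omega1 ->
     forall (k : nat) (j : {ffun 'I_d -> 'I_(2 ^ k)}),
       (POmega [set omega2 | bad c (tau / (2 * tau + 2 * m)) r omega1 omega2 j]
         <= (delta ^+ 2)%:E)%E) :
  forall (omega1 : d.-tuple R), Omega omega1 ->
  forall f : d.-tuple R -> R, measurable_fun setT f ->
    ('N[mu]_2%:E[EFin \o f] < +oo)%E ->
    (EOmega (fun omega2 =>
        'N[mu]_2%:E[EFin \o fbad mu H c (tau / (2 * tau + 2 * m)) r omega1 omega2 f])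
      <= delta%:E * 'N[mu]_2%:E[EFin \o f])%E.
Proof.
move=> w1 Ow1 f mf Nf.
have Lf := Lnorm2_square_integrable mf Nf.
rewrite Lnorm2_dotL2//; set F := Num.sqrt _.
set alpha := _ / _; set TE := transit_energy mu H c w1 f.
have F0 : 0 <= F by exact: sqrtr_ge0.
have FE : F ^+ 2 = dotL2 mu f f by rewrite sqr_sqrtr// dotL2_ge0.
(* The slack [eta] absorbs the tail of the energies and keeps [l] below positive when [F = 0]. *)
apply/lee_addgt0Pr => eta eta0; rewrite -EFinM -EFinD.
have hs : has_sup (range TE).
  split; first by exists (TE 0), 0%N.
  by exists (dotL2 mu f f) => _ [k _ <-]; exact: transit_energy_le.
(* [n] is chosen so that the energies beyond generation [n] add up to less than [eta ^+ 2]. *)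
have [_ [n _ <-] TEn] := sup_adherent (exprn_gt0 2 eta0) hs.
have tail0 : 0 <= sup (range TE) - TE n.
  by rewrite subr_ge0; apply: sup_upper_bound => //; exists n.
set tail := sup (range TE) - TE n in tail0.
have tail_le : tail <= eta ^+ 2 by rewrite /tail lerBlDl -lerBlDr ltW.
set l := delta * F + eta.
have l0 : 0 < l by rewrite ltr_wpDl// mulr_ge0// ltW.
have be0 w2 : 0 <= bad_energy mu H c alpha r w1 f w2 n.
  apply: sumr_ge0 => k _; apply: sumr_ge0 => j _.
  by rewrite mulr_ge0// energy_ge0.
have i0 : 0 <= (2 * l)^-1 by rewrite invr_ge0 mulr_ge0// ltW.
(* Before additivity is used, the norm of [fbad] is replaced by an affine function of [bad_energy],
   which is measurable in [w2]. *)
apply: (@le_trans _ _ (EOmega (fun w2 =>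
    ((2 * l)^-1 * bad_energy mu H c alpha r w1 f w2 n
      + (tail / (2 * l) + l / 2))%:E))).
  apply: le_EOmega => w2; first exact: Lnorm_ge0.
  apply: le_trans (Lnorm2_fbad_le H c alpha r w1 Lf w2 n) _.
  rewrite lee_fin; apply: le_trans (sqrt_le_amgm _ l0) _.
    by rewrite addr_ge0.
  by rewrite mulrDl addrA [_^-1 * _]mulrC.
apply: le_trans (EOmega_bad_energy_le mu H f n i0 _ (Hprob w1 Ow1)) _.
  by rewrite addr_ge0// divr_ge0// ?mulr_ge0// ltW.
rewrite lee_fin.
have TF : TE n <= F ^+ 2 by rewrite FE; exact: transit_energy_le.
(* Under this inequality the bound is at most [l ^+ 2 / (2 * l) + l / 2], which equals
   [l = delta * F + eta]. *)
suff : delta ^+ 2 * TE n + tail <= l ^+ 2.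
  move=> /(ler_wpM2r i0); have -> : l ^+ 2 / (2 * l) = l / 2.
    by field; rewrite gt_eqF.
  by rewrite mulrDl mulrC -/TE; lra.
apply: (@le_trans _ _ (delta ^+ 2 * F ^+ 2 + eta ^+ 2)).
  by rewrite lerD// ler_wpM2l// sqr_ge0.
(* The cross term in the expansion of [l ^+ 2] is nonnegative. *)
have : 0 <= delta * F * eta by rewrite !mulr_ge0// ltW.
by rewrite /l; nra.
Qed.
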